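(* Let $C$ be a circle of perimeter $1$, $T$ an equilateral triangle of perimeter $1$, and $R'$ any rectangle of perimeter $1$. Then there is a convex set in $\mathbb{R}^2$ of area at most $0.09763$ which contains a congruent copy (image under a translation and rotation) of each of $R'$, $C$ and $T$. *)

(* Defs.v *)
From HB Require Import structures.
From mathcomp Require Import all_boot all_order all_algebra.
From mathcomp Require Import all_classical all_reals all_analysis.
Set Implicit Arguments. Unset Strict Implicit. Unset Printing Implicit Defensive.
Import Order.TTheory GRing.Theory Num.Theory.
Local Open Scope classical_set_scope.
Local Open Scope ring_scope.

Definition area (R : realType) (A : set (R * R)) : \bar R :=
  ((@lebesgue_measure R) \x (@lebesgue_measure R))%E A.

Definition convex_set2 (R : realType) (K : set (R * R)) : Prop :=
  forall p q : R * R, K p -> K q -> forall t : R, 0 <= t -> t <= 1 ->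
    K (t * p.1 + (1 - t) * q.1, t * p.2 + (1 - t) * q.2).

Definition rigid_motion (R : realType) (th a b : R) (p : R * R) : R * R :=
  (cos th * p.1 - sin th * p.2 + a, sin th * p.1 + cos th * p.2 + b).

Definition contains_copy (R : realType) (K S : set (R * R)) : Prop :=
  exists th a b : R, (rigid_motion th a b) @` S `<=` K.

Definition unit_perimeter_disk (R : realType) : set (R * R) :=
  [set p | p.1 ^+ 2 + p.2 ^+ 2 <= (2 * pi)^-1 ^+ 2].

(* The closed equilateral triangle of side 1/3 (perimeter 1) with vertices
   (0,0), (1/3,0), (1/6, sqrt 3 / 6). *)
Definition unit_perimeter_triangle (R : realType) : set (R * R) :=
  [set p | exists x y z : R, [/\ 0 <= x, 0 <= y, 0 <= z & x + y + z = 1] /\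
     p = (y * 3^-1 + z * 6^-1, z * (Num.sqrt 3 / 6))].

Definition rectangle (R : realType) (a b : R) : set (R * R) :=
  [set p | 0 <= p.1 <= a /\ 0 <= p.2 <= b].

(* Main.v *)
Require Import Defs.
From HB Require Import structures.
From Stdlib Require Import ZArith.
From mathcomp Require Import all_boot all_order all_algebra.
From mathcomp Require Import all_classical all_reals all_analysis.
From mathcomp Require Import measurable_realfun ring lra zify ssrZ.
Import Order.TTheory GRing.Theory Num.Theory.
Import numFieldNormedType.Exports.
Local Open Scope classical_set_scope.
Local Open Scope ring_scope.

(** Rotate the rectangle so that its half-length h (half of the longer side) lies
    in [1/8, 1/4[, and cut this interval into 80 pieces [p, q].  For each piece
    fix one placement of the disk, of the triangle and of the centre of the
    rectangle.  The support function of the rectangle is affine in h, so a convex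
    set containing the rectangles of half-lengths p and q contains all those in
    between.  The cover K is a polygon: the intersection of the supporting
    half-planes, in finitely many rational directions, of the union of all these
    bodies.  Its area is bounded above by cutting the parts above and below the
    x-axis into vertical strips, each bounded by a single supporting line.  With
    rational data all this is integer arithmetic, checked by computation.  The
    worst piece is near h = 0.2317 (a rectangle of length 0.4634), where the
    optimal hull has area about 0.0976273: the polygon and the piece have to be
    fine there. *)

(** * A lower bound of pi *)

(** Both angles are at most pi / 4 and one is strictly smaller, so their sum lies where [atan]
    inverts [tan], and the addition formula of [tan] applies. *)
Lemma atanD (R : realType) (x y : R) : 0 <= x <= 1 -> 0 <= y < 1 ->
  atan x + atan y = atan ((x + y) / (1 - x * y)).
Proof.
move=> /andP[x0 x1] /andP[y0 y1].
have pi0 := pi_gt0 R.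
have ax0 : 0 <= atan x by rewrite -(@atan0 R) le_atan.
have ay0 : 0 <= atan y by rewrite -(@atan0 R) le_atan.
have ax1 : atan x <= pi / 4 by rewrite -atan1 le_atan.
have ay1 : atan y < pi / 4 by rewrite -atan1 lt_atan.
have cos_neq0 z : cos (atan z) != 0 :> R.
  by rewrite gt_eqF// cos_gt0_pihalf// atan_gtNpi2 atan_ltpi2.
rewrite -[LHS]tanK ?tanD ?atanK//.
by rewrite in_itv/=; apply/andP; split; lra.
Qed.

(** The difference of the two sides vanishes at 0 and has derivative t^8 / (1 + t^2) >= 0: the
    degree 7 Taylor polynomial is the integral of a truncated geometric series. *)
Lemma atan_ge_taylor7 (R : realType) (x : R) : 0 <= x ->
  x - x ^+ 3 / 3 + x ^+ 5 / 5 - x ^+ 7 / 7 <= atan x.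
Proof.
pose f (t : R) := atan t - (t - t ^+ 3 / 3 + t ^+ 5 / 5 - t ^+ 7 / 7).
have df (t : R) : is_derive t 1 f (t ^+ 8 / (1 + t ^+ 2)).
  rewrite /f; apply: is_derive_eq.
  have t2 : 1 + t ^+ 2 != 0 by rewrite gt_eqF// ltr_pwDl// sqr_ge0.
  rewrite /GRing.scale /=; field.
  done.
rewrite le_eqVlt => /predU1P[<-|x0].
  by rewrite atan0 !expr0n /= !mul0r !subr0 addr0.
have cf : {within `[0, x], continuous f}.
  by apply: derivable_within_continuous => z _; exact: ex_derive.
have [c _ ] := MVT x0 (fun z _ => df z) cf.
have -> : f 0 = 0 by rewrite /f atan0 !expr0n /= !mul0r !subr0 addr0 subr0.
rewrite !subr0 => fx.
by rewrite -subr_ge0 -[X in 0 <= X]/(f x) fx mulr_ge0// ?divr_ge0 ?addr_ge0 ?exprn_even_ge0 ?ltW.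
Qed.

Lemma atan_le_id (R : realType) (x : R) : 0 <= x -> atan x <= x.
Proof.
pose f (t : R) := t - atan t.
have df (t : R) : is_derive t 1 f (t ^+ 2 / (1 + t ^+ 2)).
  rewrite /f; apply: is_derive_eq.
  have t2 : 1 + t ^+ 2 != 0 by rewrite gt_eqF// ltr_pwDl// sqr_ge0.
  field.
  done.
rewrite le_eqVlt => /predU1P[<-|x0]; first by rewrite atan0.
have cf : {within `[0, x], continuous f}.
  by apply: derivable_within_continuous => z _; exact: ex_derive.
have [c _ ] := MVT x0 (fun z _ => df z) cf.
have -> : f 0 = 0 by rewrite /f atan0 subr0.
rewrite !subr0 => fx.
by rewrite -subr_ge0 -[X in 0 <= X]/(f x) fx mulr_ge0// ?divr_ge0 ?addr_ge0 ?sqr_ge0 ?ltW.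
Qed.

(* Machin's formula pi / 4 = 4 atan (1/5) - atan (1/239) *)
Lemma pi_gt (R : realType) : 355 / 113 - 13 / 10 ^+ 7 <= pi :> R.
Proof.
(* Doubling the angle twice takes 1/5 to 5/12 and then to 120/119, which is also the tangent of pi /
   4 + atan (1/239). *)
have sq5 : atan 5^-1 + atan 5^-1 = atan (5 / 12) :> R.
  by rewrite atanD; [congr atan; field|lra|lra].
have sq512 : atan (5 / 12) + atan (5 / 12) = atan (120 / 119) :> R.
  by rewrite atanD; [congr atan; field|lra|lra].
have sq239 : atan 1 + atan 239^-1 = atan (120 / 119) :> R.
  by rewrite atanD; [congr atan; field|lra|lra].
(* The truncations cost at most 16 / (9 * 5^9) + 4 / (3 * 239^3) < 1.01 / 10^6, while the claimed
   bound lies about 1.03 / 10^6 below pi. *)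
have := @atan_ge_taylor7 R 5^-1 ltac:(lra).
have := @atan_le_id R 239^-1 ltac:(lra).
move: sq239; rewrite atan1.
lra.
Qed.

(** * Areas of strips *)

(** The integrand is the affine function with value [h1] at [p] and [h2] at [q], so this is the area
    of a trapezoid. *)
Lemma integral_affine (R : realType) (p q h1 h2 : R) : p < q ->
  (\int[lebesgue_measure]_(x in `[p, q])
     ((h1 * (q - x) + h2 * (x - p)) / (q - p))%:E = ((q - p) * (h1 + h2) / 2)%:E)%E.
Proof.
move=> pq; have qp0 : q - p != 0 by rewrite subr_eq0 gt_eqF.
pose F (x : R) := (h2 * (x - p) ^+ 2 - h1 * (q - x) ^+ 2) / (2 * (q - p)).
have dF (x : R) : is_derive x 1 F ((h1 * (q - x) + h2 * (x - p)) / (q - p)).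
  rewrite /F; apply: is_derive_eq.
  rewrite /GRing.scale /=; field.
  done.
rewrite (@continuous_FTC2 _ _ F)//.
- by rewrite -EFinB /F; congr EFin; field.
- apply: derivable_within_continuous => x _.
  exact: ex_derive.
- split.
  + by move=> x _; apply: ex_derive.
  + apply: cvg_at_right_filter.
    by apply: differentiable_continuous; apply/derivable1_diffP; apply: ex_derive.
  + apply: cvg_at_left_filter.
    by apply: differentiable_continuous; apply/derivable1_diffP; apply: ex_derive.
- by move=> x _; rewrite derive1E derive_val.
Qed.

Lemma measurable_halfplane (R : realType) (a b c : R) :
  measurable [set z : R * R | a * z.1 + b * z.2 <= c].
Proof.
rewrite (_ : [set _ | _] = setT `&` (fun z : R * R => a * z.1 + b * z.2) @^-1` `]-oo, c]).
  apply: measurable_funD => //; apply: measurable_funM => //.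
by rewrite setTI; apply/seteqP; split=> z /=; rewrite in_itv.
Qed.

(** Cavalieri's principle: only the length of each vertical section counts, so the lower end [lo]
    may depend on x in any way. *)
Lemma strip_area_le (R : realType) (T : set (R * R)) (p q h1 h2 : R) :
  measurable T -> p <= q -> 0 <= h1 -> 0 <= h2 ->
  (forall z, T z -> p <= z.1 <= q) ->
  (p < q -> forall x, p <= x <= q -> exists lo, forall y, T (x, y) ->
     lo <= y <= lo + (h1 * (q - x) + h2 * (x - p)) / (q - p)) ->
  (area T <= ((q - p) * (h1 + h2) / 2)%:E)%E.
Proof.
move=> mT; rewrite le_eqVlt => /predU1P[<-|pq] h10 h20 Tpq Th.
  (* A strip of width 0 lies on a vertical line, which is a null set. Such strips arise when a
     breakpoint is clamped. *)
  have sub : T `<=` [set p] `*` setT.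
    by move=> z /Tpq; rewrite -eq_le => /eqP.
  rewrite subrr !mul0r /area.
  have /le_trans -> // : (((@lebesgue_measure R) \x (@lebesgue_measure R)) T <=
      ((@lebesgue_measure R) \x (@lebesgue_measure R)) ([set p] `*` setT))%E.
    by apply: le_measure => //; rewrite inE//; exact: measurableX.
  by rewrite product_measure1E// [X in (X * _)%E](lebesgue_measure_set1 p) mul0e.
rewrite -integral_affine// /area /product_measure1 /= [leRHS]integral_mkcond.
have hge0 x : p <= x <= q -> 0 <= (h1 * (q - x) + h2 * (x - p)) / (q - p).
  move=> /andP[px xq].
  by rewrite divr_ge0 ?subr_ge0 ?(ltW pq)// addr_ge0// mulr_ge0// subr_ge0.
apply: ge0_le_integral => //.
- exact: measurable_fun_xsection.
- apply/(measurable_restrictT _ _).1 => //.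
  apply/measurable_EFinP; apply: measurable_funM => //.
  by apply: measurable_funD => //; apply: measurable_funM => //;
    apply: measurable_funB.
- move=> x _ /=; rewrite patchE; case: ifPn => [/set_mem /=|].
    rewrite in_itv /= => xpq; have [lo Tlo] := Th pq _ xpq.
    have := hge0 _ xpq; move: Tlo; set h := (X in X%:E) => Tlo h0.
    have sub : xsection T x `<=` `[lo, lo + h].
      by move=> y; rewrite /xsection /= inE in_itv /= => /Tlo.
    have /le_trans -> // : (lebesgue_measure (xsection T x) <=
        lebesgue_measure (`[lo, (lo + h)%R] : set R))%E.
      by apply: le_measure => //; rewrite inE//; exact: measurable_xsection.
    rewrite lebesgue_measure_itv /=; case: ifPn => _; last by rewrite lee_fin.
    by rewrite -EFinB addrAC subrr add0r.
  move=> xpq; rewrite (_ : xsection T x = set0) ?measure0//.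
  rewrite -subset0 => y; rewrite /xsection /= inE => /Tpq /= pxq.
  by move: xpq; rewrite notin_setE /= in_itv /= pxq.
Qed.

(** * The integer certificate *)

Section Certificate.
Local Open Scope Z_scope.

(* All lengths are integers in units of 10^-8.  A triple (u, v, c) is the line
   u x + v y = c bounding from above the part y >= 0 of a convex region; the part
   y <= 0 is reflected. *)

(** The trapezoid under the line has heights (c - u p) / v and (c - u q) / v. Negative heights are
    replaced by 0, and the final 1 turns the rounded-down quotient into an upper bound. *)
Definition strip_bound (l : Z * Z * Z) (p q : Z) : Z :=
  let: (u, v, c) := l in
  (q - p) * (Z.max 0 (c - u * p) + Z.max 0 (c - u * q)) / (2 * v) + 1.

(** Cramer's rule for the abscissa of the intersection, rounded down. Parallel lines give the
    default 0, which is as sound as any other breakpoint. *)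
Definition crossing (l l' : Z * Z * Z) : Z :=
  let: (u, v, c) := l in let: (u', v', c') := l' in
  (v' * c - v * c') / (u * v' - u' * v).

(** The abscissa c / u where the line meets the x-axis, rounded up here and down in [left_end], that
    is, outwards in both cases. *)
Definition right_end (l : Z * Z * Z) : Z :=
  let: (u, _, c) := l in - (- c / u).

Definition left_end (l : Z * Z * Z) : Z :=
  let: (u, _, c) := l in c / u.

(* The breakpoints between strips are rounded: any nondecreasing choice gives an
   upper bound, so the lines need not be sorted nor the crossings exact. *)
Fixpoint cap_bound (p : Z) (l : Z * Z * Z) (ls : seq (Z * Z * Z)) : Z :=
  if ls is l' :: ls' then
    let q := Z.max p (crossing l l') in
    strip_bound l p q + cap_bound q l' ls'
  else strip_bound l p (Z.max p (right_end l)).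

(** A positive v makes each line an upper bound for y; a positive u in the last line closes the cap
    on the right. A negative u in the first line, tested in [cap_check], closes it on the left. *)
Fixpoint cap_ok (l : Z * Z * Z) (ls : seq (Z * Z * Z)) : bool :=
  let: (u, v, _) := l in
  (0 <? v) && (if ls is l' :: ls' then cap_ok l' ls' else 0 <? u).

(* A triple (x, y, r) is here the ball of centre (x, y) and radius r.  Normals are
   (2t, 1 - t^2) with t = p / q, so that their length 1 + t^2 is rational. *)
Definition support (balls : seq (Z * Z * Z)) (t : Z * Z) : Z * Z * Z :=
  let: (p, q) := t in
  let u := 2 * p * q in
  let v := q * q - p * p in
  let w := q * q + p * p in
  (u, v, foldr (fun '(x, y, r) c => Z.max (u * x + v * y + r * w) c) 0 balls).

Definition mirror (balls : seq (Z * Z * Z)) : seq (Z * Z * Z) :=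
  [seq (b.1.1, - b.1.2, b.2) | b <- balls].

(** Common denominator of the tangents of half-angles in the table, both for normals and for
    [tilt]. *)
Definition resolution : Z := 1000000.

(* A pair t1 < t2 stands for an arc of the disk between two tangents, where the
   tangents at the multiples of 1/128 are inserted; t1 = t2 stands for a single
   line along an edge of the hull. *)
Definition arc (t : Z * Z) : seq (Z * Z) :=
  let: (t1, t2) := t in
  if t1 =? t2 then [:: (t1, resolution)] else
  let i := t1 * 128 / resolution in
  let j := (t2 * 128 - 1) / resolution in
  (t1, resolution) ::
  rcons [seq (i + Z.of_nat k, 128) | k <- iota 1 (Z.to_nat (j - i))] (t2, resolution).

(* [tilt / resolution] is tan (theta / 2) for the rotation angle theta of the triangle, and
   [disk_y] moves the disk off the origin so that the x-axis runs through the
   extreme vertices of the hull. *)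
Record placement := Placement {
  half_length : Z; tilt : Z; disk_y : Z; tri_x : Z; tri_y : Z;
  rect_x : Z; rect_y : Z; upper : seq (Z * Z); lower : seq (Z * Z) }.

Definition unit_length : Z := 100000000.

Definition quarter : Z := 25000000.

Definition eighth : Z := 12500000.

(* An upper bound of 1 / (2 pi). *)
Definition disk_radius : Z := 15915500.

Definition sqrt3_floor : Z := 173205080.

(** The half-sides add up to 1/4. When h varies, each corner thus moves along a line of slope 1 or
    -1; the hull edges traced in this way have normals at 45 degrees, whence the entries close to
    tan (pi / 8) = 0.414214 in the table. *)
Definition corners (cx cy h : Z) : seq (Z * Z * Z) :=
  let k := quarter - h in
  [:: (cx - h, cy - k, 0); (cx - h, cy + k, 0);
      (cx + h, cy - k, 0); (cx + h, cy + k, 0)].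

(* The vertices other than the first are irrational; the radius 3 absorbs the
   rounding of their coordinates. *)
Definition triangle_balls (t x y : Z) : seq (Z * Z * Z) :=
  let C := resolution * resolution - t * t in
  let D := 2 * t * resolution in
  let W := resolution * resolution + t * t in
  [:: (x, y, 3);
      (x + unit_length * C / (3 * W), y + unit_length * D / (3 * W), 3);
      (x + (unit_length * C - sqrt3_floor * D) / (6 * W),
       y + (unit_length * D + sqrt3_floor * C) / (6 * W), 3)].

(** The two lists of corners are those of the rectangles at both ends of the piece, with a common
    centre. *)
Definition balls (h : Z) (P : placement) : seq (Z * Z * Z) :=
  (0, disk_y P, disk_radius) ::
  triangle_balls (tilt P) (tri_x P) (tri_y P) ++
  corners (rect_x P) (rect_y P) h ++
  corners (rect_x P) (rect_y P) (half_length P).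

Definition cap_check (ls : seq (Z * Z * Z)) : option Z :=
  if ls is l :: ls' then
    if (l.1.1 <? 0) && cap_ok l ls' then Some (cap_bound (left_end l) l ls')
    else None
  else None.

Definition lines (bs : seq (Z * Z * Z)) (arcs : seq (Z * Z)) :=
  [seq support bs t | t <- flatten (map arc arcs)].

(** The test is (A + B) / [unit_length]^2 <= 0.09763, cleared of denominators. *)
Definition placement_ok (h : Z) (P : placement) : bool :=
  let bs := balls h P in
  match cap_check (lines bs (upper P)), cap_check (lines (mirror bs) (lower P)) with
  | Some A, Some B => 1000 * (100 * (A + B)) <=? (97 * 100 + 63) * (unit_length * unit_length)
  | _, _ => false
  end.

(** Each piece starts where the previous one ends and the last must reach 1/4, so no half-length is
    missed. *)
Fixpoint table_ok (h : Z) (Ps : seq placement) : bool :=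
  if Ps is P :: Ps' then placement_ok h P && table_ok (half_length P) Ps'
  else quarter <=? h.

End Certificate.

(** * Integers of the certificate as ring elements *)

(* Locked so that the large constants never unfold to unary naturals. *)
HB.lock Definition zr (R : pzRingType) (z : Z) : R := (int_of_Z z)%:~R.

Lemma zrD (R : pzRingType) (x y : Z) : zr R (Z.add x y) = zr R x + zr R y.
Proof. by rewrite !zr.unlock -[Z.add x y]/(x + y) rmorphD intrD. Qed.

Lemma zrN (R : pzRingType) (x : Z) : zr R (Z.opp x) = - zr R x.
Proof. by rewrite !zr.unlock -[Z.opp x]/(- x) rmorphN mulrNz. Qed.

Lemma zrB (R : pzRingType) (x y : Z) : zr R (Z.sub x y) = zr R x - zr R y.
Proof. by rewrite -zrN -zrD. Qed.

Lemma zrM (R : pzRingType) (x y : Z) : zr R (Z.mul x y) = zr R x * zr R y.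
Proof. by rewrite !zr.unlock -[Z.mul x y]/(x * y) rmorphM intrM. Qed.

Definition zrE := (zrM, zrB, zrD, zrN).

Lemma ler_zr (R : numDomainType) (x y : Z) : Z.le x y -> zr R x <= zr R y.
Proof.
move=> xy; rewrite -subr_ge0 -zrB zr.unlock ler0z.
have : Z.le 0 (Z.sub y x) by lia.
by case: (Z.sub y x) => // p; case.
Qed.

Lemma ltr_zr (R : numDomainType) (x y : Z) : Z.lt x y -> zr R x < zr R y.
Proof.
move=> xy; have /(ler_zr R) : Z.le (Z.add x 1) y by lia.
by rewrite zrD; apply: lt_le_trans; rewrite ltrDl zr.unlock ltr01.
Qed.

Lemma zr_ge0 (R : numDomainType) (x : Z) : Z.le 0 x -> 0 <= zr R x.
Proof. by move=> /(ler_zr R); rewrite {1}zr.unlock. Qed.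

Lemma zr_gt0 (R : numDomainType) (x : Z) : Z.lt 0 x -> 0 < zr R x.
Proof. by move=> /(ltr_zr R); rewrite {1}zr.unlock. Qed.

(** * Polygons *)

Section polygons.
Context {R : realType}.
Implicit Types (P : set (R * R)) (z : R * R) (hs : seq (R * R * R)).

Fixpoint polygon hs : set (R * R) :=
  if hs is h :: hs' then [set z | h.1.1 * z.1 + h.1.2 * z.2 <= h.2] `&` polygon hs'
  else setT.

(** The closed convex hull, as the intersection of all closed half-planes that contain [P]. In this
    form it is compared with polygons and support functions directly. *)
Definition closed_hull P : set (R * R) :=
  [set z | forall u v c, (forall w : R * R, P w -> u * w.1 + v * w.2 <= c) ->
     u * z.1 + v * z.2 <= c].

Lemma measurable_polygon hs : measurable (polygon hs).
Proof.
elim: hs => //= h hs IH; apply: measurableI => //; exact: measurable_halfplane.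
Qed.

Lemma polygon_cat hs hs' : polygon (hs ++ hs') = polygon hs `&` polygon hs'.
Proof. by elim: hs => [|h hs IH] /=; rewrite ?setTI// IH setIA. Qed.

Lemma closed_hull_polygon P hs : P `<=` polygon hs -> closed_hull P `<=` polygon hs.
Proof.
elim: hs => //= h hs IH Phs z Pz; split; first by apply: Pz => w /Phs[].
by apply: IH Pz => w /Phs[].
Qed.

Lemma convex_polygon hs : convex_set2 (polygon hs).
Proof.
elim: hs => //= h hs IH x y [xh xhs] [yh yhs] t t0 t1; split; last exact: IH.
move: xh yh => /= xh yh; set a := h.1.1 in xh yh *; set b := h.1.2 in xh yh *.
have -> : a * (t * x.1 + (1 - t) * y.1) + b * (t * x.2 + (1 - t) * y.2) =
  t * (a * x.1 + b * x.2) + (1 - t) * (a * y.1 + b * y.2) by ring.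
have -> : h.2 = t * h.2 + (1 - t) * h.2 by ring.
by apply: lerD; apply: ler_wpM2l => //; rewrite subr_ge0.
Qed.

Lemma area_setU (A B C : set (R * R)) (a b : R) :
  measurable A -> measurable B -> measurable C -> C `<=` A `|` B ->
  (area A <= a%:E)%E -> (area B <= b%:E)%E -> (area C <= (a + b)%:E)%E.
Proof.
move=> mA mB mC CAB Aa Bb.
have : (area C <= area (A `|` B))%E.
  by apply: le_measure => //; rewrite inE//; exact: measurableU.
move=> /le_trans; apply; rewrite EFinD.
by apply: le_trans (leeD Aa Bb); exact: measureU2.
Qed.

End polygons.

(** * Soundness of the certificate *)

Lemma Z_div_ceil (a b : Z) : Z.lt 0 b -> Z.le a (Z.mul (Z.add (Z.div a b) 1) b).
Proof. by move=> b0; have := Z.mul_succ_div_gt a b b0; lia. Qed.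

(** * Areas of the caps above and below the x-axis *)

Section Caps.
Context {R : realType}.
Notation S := (zr R unit_length).

Lemma unit_length_gt0 : 0 < S.
Proof. by apply: zr_gt0. Qed.

(** The lower cap is stored reflected; s = -1 reflects its lines back, and s = 1 is used for the
    upper cap. *)
Definition line (s : R) (l : Z * Z * Z) : R * R * R :=
  let: (u, v, c) := l in (zr R u, s * zr R v, zr R c / S).

Definition slab (s p q : R) : set (R * R) :=
  [set z | p <= z.1] `&` [set z | z.1 <= q] `&` [set z | 0 <= s * z.2].

Lemma measurable_ge1 (p : R) : measurable [set z : R * R | p <= z.1].
Proof.
rewrite (_ : [set _ | _] = [set z : R * R | -1 * z.1 + 0 * z.2 <= - p]).
  exact: measurable_halfplane.
by apply/seteqP; split => z /=; rewrite mul0r addr0 mulN1r lerN2.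
Qed.

Lemma measurable_le1 (p : R) : measurable [set z : R * R | z.1 <= p].
Proof.
rewrite (_ : [set _ | _] = [set z : R * R | 1 * z.1 + 0 * z.2 <= p]).
  exact: measurable_halfplane.
by apply/seteqP; split => z /=; rewrite mul0r addr0 mul1r.
Qed.

Lemma measurable_ge2 (s : R) : measurable [set z : R * R | 0 <= s * z.2].
Proof.
rewrite (_ : [set _ | _] = [set z : R * R | 0 * z.1 + - s * z.2 <= 0]).
  exact: measurable_halfplane.
by apply/seteqP; split => z /=; rewrite mul0r add0r mulNr oppr_le0.
Qed.

Lemma measurable_slab (s p q : R) : measurable (slab s p q).
Proof.
apply: measurableI; last exact: measurable_ge2.
by apply: measurableI; [exact: measurable_ge1|exact: measurable_le1].
Qed.

(** The height under a line is affine in x, hence at most the interpolation of its end values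
    clamped at 0; [strip_area_le] then gives the area of the trapezoid. *)
Lemma strip_boundP (s : R) (l : Z * Z * Z) (p q : Z) :
  s = 1 \/ s = -1 -> Z.lt 0 l.1.2 -> Z.le p q ->
  (area (slab s (zr R p / S) (zr R q / S) `&` polygon [:: line s l])
     <= (zr R (strip_bound l p q) / S ^+ 2)%:E)%E.
Proof.
case: l => [[u v] c] s1 /= v0 pq.
have S0 := unit_length_gt0.
set m1 := Z.max 0 (Z.sub c (Z.mul u p)).
set m2 := Z.max 0 (Z.sub c (Z.mul u q)).
have vR : 0 < zr R v by exact: zr_gt0.
have pqR : zr R p <= zr R q by exact: ler_zr.
have m10 : 0 <= zr R m1 by apply: zr_ge0; lia.
have m20 : 0 <= zr R m2 by apply: zr_ge0; lia.
have m1c : zr R c - zr R u * zr R p <= zr R m1.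
  by rewrite -zrM -zrB; apply: ler_zr; lia.
have m2c : zr R c - zr R u * zr R q <= zr R m2.
  by rewrite -zrM -zrB; apply: ler_zr; lia.
have vS0 : 0 < zr R v * S by exact: mulr_gt0.
apply: (@le_trans _ _ ((zr R q / S - zr R p / S) *
    (zr R m1 / (zr R v * S) + zr R m2 / (zr R v * S)) / 2)%:E).
  apply: strip_area_le.
  - apply: measurableI; first exact: measurable_slab.
    exact: (measurable_polygon [:: line s (u, v, c)]).
  - by rewrite ler_pM2r ?invr_gt0.
  - by rewrite divr_ge0// ltW.
  - by rewrite divr_ge0// ltW.
  - by move=> z [[[/= -> ->]]].
  - move=> pq' x /andP[px xq].
    have {}pq' : 0 < zr R q / S - zr R p / S by rewrite subr_gt0.
    set H := (X in X / (_ - _)).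
    (* The section starts at the x-axis for the upper cap and ends there for the lower one. *)
    exists (if s == 1 then 0 else - (H / (zr R q / S - zr R p / S))).
    move=> y [[[/= _ _] sy] [uvc _]].
    have : s * y <= H / (zr R q / S - zr R p / S).
      rewrite ler_pdivlMr// -(ler_pM2l vS0) /H.
      set P := zr R p / S in px pq' *; set Q := zr R q / S in xq pq' *.
      have pP : zr R p = P * S by rewrite divfK// gt_eqF.
      have qQ : zr R q = Q * S by rewrite divfK// gt_eqF.
      have -> : zr R v * S * (zr R m1 / (zr R v * S) * (Q - x) +
          zr R m2 / (zr R v * S) * (x - P)) = zr R m1 * (Q - x) + zr R m2 * (x - P).
        by field; rewrite !gt_eqF.
      move: m1c m2c uvc; rewrite pP qQ; set c' := zr R c / S.
      have -> : zr R c = c' * S by rewrite divfK// gt_eqF.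
      move=> m1c m2c uvc.
      (* The sum of the left sides of [le1] and [le2] is S (c' - u x) (Q - P), which [le3] compares
         with the ordinate. *)
      have le1 : (c' * S - zr R u * (P * S)) * (Q - x) <= zr R m1 * (Q - x).
        by rewrite ler_wpM2r// subr_ge0.
      have le2 : (c' * S - zr R u * (Q * S)) * (x - P) <= zr R m2 * (x - P).
        by rewrite ler_wpM2r// subr_ge0.
      have le3 : (zr R u * x + s * zr R v * y) * (S * (Q - P)) <= c' * (S * (Q - P)).
        by rewrite ler_wpM2r// mulr_ge0// ltW.
      lra.
    case: s1 sy => ->; rewrite ?eqxx.
      by rewrite mul1r add0r => -> ->.
    have -> : (-1 == 1 :> R) = false by apply/negP => /eqP; lra.
    by move=> sy sH; apply/andP; split; lra.
rewrite lee_fin /strip_bound -/m1 -/m2.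
have -> : (zr R q / S - zr R p / S) *
    (zr R m1 / (zr R v * S) + zr R m2 / (zr R v * S)) / 2 =
    (zr R q - zr R p) * (zr R m1 + zr R m2) / (2 * zr R v) / S ^+ 2.
  by field; rewrite !gt_eqF.
rewrite ler_pM2r ?invr_gt0 ?exprn_gt0// ler_pdivrMr ?mulr_gt0//.
have -> : 2 * zr R v = zr R (Z.mul 2 v).
  by rewrite zrM; congr (_ * _); rewrite zr.unlock.
have v20 : Z.lt 0 (Z.mul 2 v) by lia.
by rewrite -zrB -zrD -!zrM; apply: ler_zr; exact: Z_div_ceil.
Qed.

Definition halfslab (s p : R) : set (R * R) :=
  [set z | p <= z.1] `&` [set z | 0 <= s * z.2].

Lemma measurable_halfslab (s p : R) : measurable (halfslab s p).
Proof. by apply: measurableI; [exact: measurable_ge1|exact: measurable_ge2]. Qed.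

(** Induction on the lines: the region is cut at the breakpoint, the first line bounding the strip
    on its left and the other lines the rest. *)
Lemma cap_boundP (s : R) (l : Z * Z * Z) (ls : seq (Z * Z * Z)) (p : Z) :
  s = 1 \/ s = -1 -> cap_ok l ls ->
  (area (halfslab s (zr R p / S) `&` polygon (map (line s) (l :: ls)))
     <= (zr R (cap_bound p l ls) / S ^+ 2)%:E)%E.
Proof.
move=> s1; elim: ls l p => [|l' ls IH] l p.
  case: l => [[u v] c] /=; set q := Z.max _ _ => /andP[/Z.ltb_lt v0 /Z.ltb_lt u0].
  have pq : Z.le p q by lia.
  have S0 := unit_length_gt0.
  apply: le_trans (strip_boundP s (u, v, c) p q s1 v0 pq).
  apply: le_measure; rewrite ?inE.
  - apply: measurableI; first exact: measurable_halfslab.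
    exact: (measurable_polygon [:: line s (u, v, c)]).
  - apply: measurableI; first exact: measurable_slab.
    exact: (measurable_polygon [:: line s (u, v, c)]).
  (* The ordinate term is nonnegative, so u x <= c; since u > 0, this bounds x by the rounded-up
     quotient [right_end]. *)
  - move=> z [[/= pz sz] [uvc _]]; split => //; split => //; split => //=.
    have v0R := zr_gt0 R _ v0; have u0R := zr_gt0 R _ u0.
    have uz : zr R u * z.1 <= zr R c / S.
      by apply: le_trans uvc; rewrite lerDl -mulrA mulrCA mulr_ge0// ltW.
    rewrite ler_pdivlMr// -(ler_pM2l u0R) mulrA.
    move: uz; rewrite ler_pdivlMr// => /le_trans; apply.
    rewrite -zrM; apply: ler_zr.
    rewrite /q /=; have := Z.mul_div_le (Z.opp c) u u0; nia.
move=> /=; case: l => [[u v] c] /andP[/Z.ltb_lt v0 ok'].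
set q := Z.max _ _.
have pq : Z.le p q by lia.
rewrite zrD mulrDl.
apply: area_setU (strip_boundP s (u, v, c) p q s1 v0 pq) (IH l' q ok').
- by apply: measurableI; [exact: measurable_slab|exact: measurable_polygon].
- by apply: measurableI; [exact: measurable_halfslab|exact: measurable_polygon].
- apply: measurableI; [exact: measurable_halfslab|].
  exact: (measurable_polygon (map (line s) ((u, v, c) :: l' :: ls))).
- move=> z [[/= pz sz] [uvc [lz lsz]]].
  (* Left of the breakpoint only the first line is kept, right of it only the others; forgetting
     lines enlarges the set. *)
  have [zq|/ltW qz] := leP z.1 (zr R q / S); first by left; do !split.
  by right; do !split.
Qed.

End Caps.

(** * Supporting lines of balls, and the disk *)

Section Balls.
Context {R : realType}.
Notation S := (zr R unit_length).

(** The first line has u < 0, so on the cap it bounds x from below by c / u, and the cap lies in the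
    half-slab starting at [left_end]. *)
Lemma cap_checkP (s : R) (ls : seq (Z * Z * Z)) (A : Z) :
  s = 1 \/ s = -1 -> cap_check ls = Some A ->
  (area (polygon (map (line s) ls) `&` [set z | (0 <= s * z.2)%R])
     <= (zr R A / S ^+ 2)%:E)%E.
Proof.
case: ls => // -[[u v] c] ls s1; rewrite /cap_check [(_, _).1.1]/=.
case: ifP => // /andP[/Z.ltb_lt u0 ok] [<-].
apply: le_trans (cap_boundP s _ _ _ s1 ok).
apply: le_measure; rewrite ?inE.
- by apply: measurableI; [exact: measurable_polygon|exact: measurable_ge2].
- by apply: measurableI; [exact: measurable_halfslab|exact: measurable_polygon].
move=> z [[uvc lsz] sz]; split=> //; split=> //=.
have v0 : 0 < zr R v.
  by apply: zr_gt0; move: ok; case: (ls) => [|? ?] /= /andP[/Z.ltb_lt].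
have u0R : 0 < - zr R u by rewrite -zrN; apply: zr_gt0; lia.
have S0 := @unit_length_gt0 R.
have uz : zr R u * z.1 <= zr R c / S.
  by apply: le_trans uvc; rewrite lerDl /= -mulrA mulrCA mulr_ge0// ltW.
rewrite ler_pdivrMr// -(ler_pM2l u0R) !mulNr lerN2 mulrA.
move: uz; rewrite ler_pdivlMr// => /le_trans; apply.
by rewrite -zrM; apply: ler_zr; exact: Z.mul_div_ge.
Qed.

Definition ball_at (b : Z * Z * Z) : set (R * R) :=
  [set z | (S * z.1 - zr R b.1.1) ^+ 2 + (S * z.2 - zr R b.1.2) ^+ 2
             <= zr R b.2 ^+ 2].

Definition balls_union (bs : seq (Z * Z * Z)) : set (R * R) :=
  [set z | exists2 b, b \in bs & ball_at b z].

Lemma ler_of_sqr (x y : R) : 0 <= y -> x ^+ 2 <= y ^+ 2 -> x <= y.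
Proof.
by move=> y0 xy; apply: le_trans (ler_norm x) _; rewrite -ler_sqr ?nnegrE// real_normK ?num_real.
Qed.

(** Cauchy-Schwarz: on a ball, the form u x + v y exceeds its value at the centre by at most the
    radius times the length of (u, v), and this length is exactly w. *)
Lemma supportP (bs : seq (Z * Z * Z)) (t : Z * Z) (b : Z * Z * Z) (z : R * R) :
  b \in bs -> Z.le 0 b.2 -> ball_at b z ->
  zr R (support bs t).1.1 * z.1 + zr R (support bs t).1.2 * z.2
    <= zr R (support bs t).2 / S.
Proof.
case: t => p q; case: b => [[x y] r] bbs /= r0; rewrite /ball_at /= => zb.
set u := Z.mul (Z.mul 2 p) q; set v := Z.sub _ _; set w := Z.add _ _.
set c := foldr _ _ _.
have S0 := @unit_length_gt0 R.
(* The maximum starts from 0, which can only enlarge [c]. *)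
have cb : Z.le (Z.add (Z.add (Z.mul u x) (Z.mul v y)) (Z.mul r w)) c.
  rewrite /c; elim: (bs) bbs => //= -[[x' y'] r'] bs' IH.
  rewrite inE => /predU1P[[-> -> ->]|/IH]; lia.
rewrite ler_pdivlMr//; apply: le_trans (ler_zr R _ _ cb).
rewrite 2!zrD (zrM _ u) (zrM _ v) (zrM _ r).
(* The Pythagorean identity (q^2 + p^2)^2 = (2 p q)^2 + (q^2 - p^2)^2. *)
have w2 : zr R w ^+ 2 = zr R u ^+ 2 + zr R v ^+ 2.
  rewrite /u /v /w !zrE; have -> : zr R 2 = 2 by rewrite zr.unlock.
  ring.
have w0 : 0 <= zr R w by apply: zr_ge0; nia.
have rR : 0 <= zr R r by exact: zr_ge0.
rewrite -subr_ge0.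
have /(ler_of_sqr _ _ (mulr_ge0 rR w0)) :
    (zr R u * (S * z.1 - zr R x) + zr R v * (S * z.2 - zr R y)) ^+ 2 <=
    (zr R r * zr R w) ^+ 2.
  rewrite exprMn w2.
  move: zb; set dx := S * z.1 - _; set dy := S * z.2 - _ => zb.
  have uv0 : 0 <= zr R u ^+ 2 + zr R v ^+ 2 by rewrite addr_ge0 ?sqr_ge0.
  apply: le_trans (ler_wpM2r uv0 zb).
  (* Lagrange's identity: this square is the defect in Cauchy-Schwarz. *)
  have := sqr_ge0 (zr R u * dy - zr R v * dx).
  lra.
by move=> uvrw; lra.
Qed.

(** The hypothesis concerns the point reflected by s, so that the same statement serves both the
    balls and their mirror images. *)
Lemma lines_ball (bs : seq (Z * Z * Z)) (arcs : seq (Z * Z)) (s : R) (z : R * R) :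
  all (fun b => Z.leb 0 b.2) bs -> balls_union bs (z.1, s * z.2) ->
  polygon (map (line s) (lines bs arcs)) z.
Proof.
move=> /allP bs0 [b bbs bz]; rewrite /lines.
elim: (flatten _) => //= t ts IH; split=> //.
have /Z.leb_le b0 := bs0 _ bbs.
have := supportP _ t _ _ bbs b0 bz.
by case: (support bs t) => [[u v] c] /=; rewrite mulrCA mulrA.
Qed.

Lemma mirror_union (bs : seq (Z * Z * Z)) (z : R * R) :
  balls_union bs z -> balls_union (mirror bs) (z.1, -1 * z.2).
Proof.
move=> [b bbs bz]; exists (b.1.1, Z.opp b.1.2, b.2); first exact: map_f.
move: bz; rewrite /ball_at /= zrN mulN1r.
by have -> : (S * - z.2 - - zr R b.1.2) ^+ 2 = (S * z.2 - zr R b.1.2) ^+ 2 by ring.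
Qed.

(** The arc cosine of x has a nonnegative sine; its sign is changed when y < 0. *)
Lemma angle_exists (x y : R) : x ^+ 2 + y ^+ 2 = 1 ->
  exists th, cos th = x /\ sin th = y.
Proof.
move=> xy1.
have x1 : -1 <= x <= 1.
  have x21 : x ^+ 2 <= 1 by rewrite -xy1 lerDl sqr_ge0.
  by apply/andP; split; nra.
have y2 : 1 - x ^+ 2 = y ^+ 2 by rewrite -xy1; ring.
have [y0|/ltW y0] := leP 0 y.
  by exists (acos x); rewrite acosK// sin_acos// y2 sqrtr_sqr ger0_norm.
exists (- acos x); rewrite cosN sinN acosK// sin_acos// y2 sqrtr_sqr.
by rewrite ler0_norm// opprK.
Qed.

Lemma zr_unit_length : S = 10 ^+ 8.
Proof.
have -> : unit_length = Z.mul (Z.mul 100 100) (Z.mul 100 100) by [].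
rewrite !zrM; have -> : zr R 100 = 100 by rewrite zr.unlock.
ring.
Qed.

Lemma zr_disk_radius : zr R disk_radius = (159 + 155 / 1000) * 10 ^+ 5.
Proof.
have -> : disk_radius = Z.mul (Z.add (Z.mul 159 1000) 155) 100 by [].
rewrite !zrE.
have -> : zr R 159 = 159 by rewrite zr.unlock.
have -> : zr R 155 = 155 by rewrite zr.unlock.
have -> : zr R 1000 = 1000 by rewrite zr.unlock.
have -> : zr R 100 = 100 by rewrite zr.unlock.
lra.
Qed.

Lemma disk_contained (K : set (R * R)) (y : Z) :
  ball_at (Z0, y, disk_radius) `<=` K -> contains_copy K (@unit_perimeter_disk R).
Proof.
move=> bK; exists 0, 0, (zr R y / S) => _ [p pd <-].
have S0 := @unit_length_gt0 R.
apply: bK; rewrite /ball_at /rigid_motion /= cos0 sin0.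
have -> : zr R Z0 = 0 by rewrite zr.unlock.
have -> : S * (1 * p.1 - 0 * p.2 + 0) - 0 = S * p.1 by ring.
have -> : S * (0 * p.1 + 1 * p.2 + zr R y / S) - zr R y = S * p.2.
  by field; rewrite gt_eqF.
rewrite !exprMn -mulrDr.
have pi0 := pi_gt0 R.
have rS : (S * (2 * pi)^-1) ^+ 2 <= zr R disk_radius ^+ 2.
  have r0 : 0 <= zr R disk_radius by apply: zr_ge0.
  have pi2 : 0 < 2 * pi :> R by rewrite mulr_gt0.
  have Spi : S / (2 * pi) <= zr R disk_radius.
    rewrite ler_pdivrMr// zr_unit_length zr_disk_radius.
    (* The rounded radius requires pi >= 10^8 / (2 * 15915500), about 3.14159153; [pi_gt] gives
       3.14159162. *)
    have := pi_gt R; lra.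
  by rewrite ler_sqr ?nnegrE// divr_ge0// ltW.
by apply: le_trans rS; rewrite exprMn ler_wpM2l ?sqr_ge0.
Qed.

End Balls.

(** * The triangle and the rectangles *)

Section Bodies.
Context {R : realType}.
Notation S := (zr R unit_length).

Lemma zr_div (a b : Z) : Z.lt 0 b ->
  zr R (Z.div a b) <= zr R a / zr R b <= zr R (Z.div a b) + 1.
Proof.
move=> b0; have b0R := zr_gt0 R _ b0.
rewrite ler_pdivlMr// ler_pdivrMr//.
have <- : zr R 1 = 1 by rewrite zr.unlock.
rewrite -zrD -!zrM; apply/andP; split; apply: ler_zr.
  by rewrite Z.mul_comm; exact: Z.mul_div_le.
exact: Z_div_ceil.
Qed.

(** Squaring reduces both bounds to comparisons of integers with 3 * 10^16. *)
Lemma sqrt3_approx : zr R sqrt3_floor <= S * Num.sqrt 3 <= zr R sqrt3_floor + 1.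
Proof.
have S0 := @unit_length_gt0 R.
have k0 : 0 <= zr R sqrt3_floor by apply: zr_ge0.
have S30 : 0 <= S * Num.sqrt 3 by rewrite mulr_ge0 ?sqrtr_ge0 ?ltW.
have : (S * Num.sqrt 3) ^+ 2 = zr R (Z.mul 3 (Z.mul unit_length unit_length)).
  rewrite exprMn sqr_sqrtr// !zrM; have -> : zr R 3 = 3 by rewrite zr.unlock.
  ring.
move: (S * _) S30 => r r0 sq3.
apply/andP; split; apply: ler_of_sqr => //.
- by rewrite sq3 expr2 -zrM; apply: ler_zr.
- by rewrite addr_ge0.
- have <- : zr R 1 = 1 by rewrite zr.unlock.
  by rewrite sq3 expr2 -zrD -zrM; apply: ler_zr.
Qed.

(** C / W and D / W are the cosine and sine of the rotation. Afterwards only C^2 + D^2 = W^2 and W >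
    0 are needed. *)
Lemma triangle_ballsE (t x y : Z) : exists C D W : Z,
  [/\ Z.lt 0 W, zr R C ^+ 2 + zr R D ^+ 2 = zr R W ^+ 2 &
   triangle_balls t x y = [:: (x, y, Z.of_nat 3);
     (Z.add x (Z.div (Z.mul unit_length C) (Z.mul (Z.of_nat 3) W)),
      Z.add y (Z.div (Z.mul unit_length D) (Z.mul (Z.of_nat 3) W)), Z.of_nat 3);
     (Z.add x (Z.div (Z.sub (Z.mul unit_length C) (Z.mul sqrt3_floor D))
        (Z.mul (Z.of_nat 6) W)),
      Z.add y (Z.div (Z.add (Z.mul unit_length D) (Z.mul sqrt3_floor C))
        (Z.mul (Z.of_nat 6) W)), Z.of_nat 3)]].
Proof.
exists (Z.sub (Z.mul resolution resolution) (Z.mul t t)).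
exists (Z.mul (Z.mul 2 t) resolution).
exists (Z.add (Z.mul resolution resolution) (Z.mul t t)).
split=> //; first by rewrite /resolution; nia.
rewrite !zrE; have -> : zr R 2 = 2 by rewrite zr.unlock.
ring.
Qed.

(** Two coordinate errors in this range give a squared distance of at most 8, below the square 9 of
    the radius in [triangle_balls]. *)
Lemma sqr_le1 (d : R) : -1 <= d <= 2 -> d ^+ 2 <= 4.
Proof. by move=> /andP[d0 d1]; nra. Qed.

(** Each vertex of the rotated triangle lies in its ball, so a half-plane containing the balls
    contains the vertices and hence their convex combinations. *)
Lemma triangle_contained (K : set (R * R)) (t x y : Z) :
  closed_hull (balls_union (triangle_balls t x y)) `<=` K ->
  contains_copy K (@unit_perimeter_triangle R).
Proof.
have [C [D [W [W0 CDW ->]]]] := triangle_ballsE t x y.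
have W3 : Z.lt 0 (Z.mul (Z.of_nat 3) W) by lia.
have W6 : Z.lt 0 (Z.mul (Z.of_nat 6) W) by lia.
have := zr_div (Z.mul unit_length C) _ W3.
have := zr_div (Z.mul unit_length D) _ W3.
have := zr_div (Z.sub (Z.mul unit_length C) (Z.mul sqrt3_floor D)) _ W6.
have := zr_div (Z.add (Z.mul unit_length D) (Z.mul sqrt3_floor C)) _ W6.
move: (Z.div _ _) (Z.div _ _) (Z.div _ _) (Z.div _ _) => x1 y1 x2 y2.
rewrite !zrB !zrD !zrM.
have r3 : zr R (Z.of_nat 3) = 3 by rewrite zr.unlock.
have -> : zr R (Z.of_nat 6) = 6 by rewrite zr.unlock.
rewrite r3; move: sqrt3_approx (zr_gt0 R _ W0) (@unit_length_gt0 R) CDW.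
move: (zr R sqrt3_floor) (zr R C) (zr R D) (zr R W) => k c d w.
move=> /andP[k1 k2] w0 S0 cdw hy2 hx2 hy1 hx1 HK.
have w1 : w != 0 by rewrite gt_eqF.
have S1 : S != 0 by rewrite gt_eqF.
have abs_le z : z ^+ 2 <= w ^+ 2 -> -1 <= z / w <= 1.
  move=> zw; rewrite ler_pdivlMr// ler_pdivrMr//; apply/andP; split; nra.
have cw : -1 <= c / w <= 1 by apply: abs_le; rewrite -cdw lerDl sqr_ge0.
have dw : -1 <= d / w <= 1 by apply: abs_le; rewrite -cdw lerDr sqr_ge0.
(* The error from replacing sqrt 3 by its rounded value; it enters the third vertex only, divided by
   6. *)
set e := S * Num.sqrt 3 - k.
have e01 : 0 <= e <= 1 by rewrite /e; apply/andP; split; lra.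
have [th [costh sinth]] : exists th, cos th = c / w /\ sin th = d / w.
  by apply: angle_exists; rewrite !expr_div_n -mulrDl cdw divff// expf_neq0.
exists th, (zr R x / S), (zr R y / S) => _ [_ [a0 [a1 [a2 [[a00 a10 a20 a1E] ->]]]] <-].
apply: HK => u v m Hm; rewrite /rigid_motion /= costh sinth.
have H0 : u * (zr R x / S) + v * (zr R y / S) <= m.
  apply: (Hm (_, _)); exists (x, y, Z.of_nat 3); rewrite ?mem_head//.
  rewrite /ball_at /= r3.
  have -> : S * (zr R x / S) - zr R x = 0 by field.
  have -> : S * (zr R y / S) - zr R y = 0 by field.
  lra.
have H1 : u * (zr R x / S + c / (3 * w)) + v * (zr R y / S + d / (3 * w)) <= m.
  apply: (Hm (_, _)); exists (Z.add x x1, Z.add y y1, Z.of_nat 3).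
    by rewrite in_cons mem_head orbT.
  rewrite /ball_at /= r3 !zrD.
  have -> : S * (zr R x / S + c / (3 * w)) - (zr R x + zr R x1) =
    S * c / (3 * w) - zr R x1 by field; apply/andP.
  have -> : S * (zr R y / S + d / (3 * w)) - (zr R y + zr R y1) =
    S * d / (3 * w) - zr R y1 by field; apply/andP.
  have := sqr_le1 (S * c / (3 * w) - zr R x1) ltac:(lra).
  have := sqr_le1 (S * d / (3 * w) - zr R y1) ltac:(lra).
  lra.
have H2 : u * (zr R x / S + (c - Num.sqrt 3 * d) / (6 * w)) +
          v * (zr R y / S + (d + Num.sqrt 3 * c) / (6 * w)) <= m.
  apply: (Hm (_, _)); exists (Z.add x x2, Z.add y y2, Z.of_nat 3).
    by rewrite 2!in_cons mem_head !orbT.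
  rewrite /ball_at /= r3 !zrD.
  have -> : S * (zr R x / S + (c - Num.sqrt 3 * d) / (6 * w)) - (zr R x + zr R x2) =
    (S * c - k * d) / (6 * w) - zr R x2 - e * (d / w) / 6.
    by rewrite /e; field; apply/andP.
  have -> : S * (zr R y / S + (d + Num.sqrt 3 * c) / (6 * w)) - (zr R y + zr R y2) =
    (S * d + k * c) / (6 * w) - zr R y2 + e * (c / w) / 6.
    by rewrite /e; field; apply/andP.
  have ed : -1 <= e * (d / w) <= 1 by apply/andP; split; nra.
  have ec : -1 <= e * (c / w) <= 1 by apply/andP; split; nra.
  have := sqr_le1 ((S * c - k * d) / (6 * w) - zr R x2 - e * (d / w) / 6) ltac:(lra).
  have := sqr_le1 ((S * d + k * c) / (6 * w) - zr R y2 + e * (c / w) / 6) ltac:(lra).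
  lra.
(* The barycentric weights a0, a1, a2 combine the inequalities [H0], [H1], [H2] at the three
   vertices. *)
apply: le_trans (_ : a0 * m + a1 * m + a2 * m <= m); last by rewrite -!mulrDl a1E mul1r.
apply: le_trans (lerD (lerD (ler_wpM2l a00 H0) (ler_wpM2l a10 H1)) (ler_wpM2l a20 H2)).
have -> : a0 = 1 - a1 - a2 by rewrite -a1E; ring.
rewrite le_eqVlt; apply/orP; left; apply/eqP; field.
by apply/andP.
Qed.

(** The support function u cx + v cy + |u| h + |v| (k - h) of the rectangle is affine in h, so a
    bound at [h1] and [h2] holds in between. *)
Lemma rectangle_hull (P : set (R * R)) (cx cy h h1 h2 k e1 e2 : R) :
  h1 <= h <= h2 -> `|e1| <= h -> `|e2| <= k - h ->
  (forall g s1 s2 : R, (g = h1 \/ g = h2) -> (s1 = 1 \/ s1 = -1) ->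
     (s2 = 1 \/ s2 = -1) -> P (cx + s1 * g, cy + s2 * (k - g))) ->
  closed_hull P (cx + e1, cy + e2).
Proof.
move=> /andP[h1h hh2] e1h e2h Pc u v c Pc' /=.
(* The corner whose signs match those of u and v attains the support function. *)
have key g : g = h1 \/ g = h2 -> u * cx + v * cy + `|u| * g + `|v| * (k - g) <= c.
  move=> gh.
  have sgE x : `|x| = (if 0 <= x then 1 else -1) * x :> R.
    by case: (leP 0 x) => x0; [rewrite mul1r ger0_norm|rewrite mulN1r ltr0_norm].
  rewrite !sgE.
  have := Pc' _ (Pc g (if 0 <= u then 1 else -1) (if 0 <= v then 1 else -1) gh _ _).
  by rewrite /=; case: ifP => _; case: ifP => _ H;
    have := H ltac:(by [left|right]) ltac:(by [left|right]); lra.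
have k1 := key h1 (or_introl erefl); have k2 := key h2 (or_intror erefl).
have ue : u * e1 <= `|u| * h.
  by apply: le_trans (ler_norm _) _; rewrite normrM ler_wpM2l.
have ve : v * e2 <= `|v| * (k - h).
  by apply: le_trans (ler_norm _) _; rewrite normrM ler_wpM2l.
(* The slope in h is |u| - |v|; its sign decides which of the two ends gives the bound. *)
have [uv|/ltW uv] := leP `|u| `|v|; nra.
Qed.

End Bodies.

Lemma zr_quarter (R : realType) : zr R quarter / zr R unit_length = 1 / 4.
Proof.
have -> : zr R unit_length = 4 * zr R quarter.
  have -> : unit_length = Z.mul 4 quarter by [].
  by rewrite zrM; congr (_ * _); rewrite zr.unlock.
by field; rewrite gt_eqF// zr_gt0.
Qed.

Lemma rectangle_corners_hull (R : realType) (cx cy p q : Z) (h e1 e2 : R) :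
  let S := zr R unit_length in
  zr R p / S <= h <= zr R q / S -> `|e1| <= h -> `|e2| <= 1 / 4 - h ->
  closed_hull (balls_union (corners cx cy p ++ corners cx cy q))
    (zr R cx / S + e1, zr R cy / S + e2).
Proof.
move=> S hpq e1h e2h; have S0 : 0 < S := unit_length_gt0.
have k4 := zr_quarter R.
apply: (rectangle_hull _ _ _ h (zr R p / S) (zr R q / S) (1 / 4)) => //.
move=> g s1 s2 gpq s11 s21.
have near (x y : Z) (a b : R) : a = zr R x / S -> b = zr R y / S ->
    ball_at (x, y, Z0) (a, b).
  move=> -> ->; rewrite /ball_at /= -/S.
  rewrite !(mulrC S) !divfK ?gt_eqF// !subrr expr0n addr0.
  exact: sqr_ge0.
have wit (x y r : Z) : r = p \/ r = q ->
   (x = Z.sub cx r \/ x = Z.add cx r) ->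
   (y = Z.sub cy (Z.sub quarter r) \/ y = Z.add cy (Z.sub quarter r)) ->
   (x, y, Z0) \in corners cx cy p ++ corners cx cy q.
  by move=> [->|->] [->|->] [->|->]; rewrite mem_cat !inE !eqxx ?orbT.
have [r [rpq gr]] : exists r, (r = p \/ r = q) /\ g = zr R r / S.
  by case: gpq => ->; [exists p|exists q]; split=> //; [left|right].
rewrite -k4 gr.
case: s11 => ->; case: s21 => ->; rewrite ?mul1r ?mulN1r.
- exists (Z.add cx r, Z.add cy (Z.sub quarter r), Z0); first by apply: (wit _ _ r); auto.
  by apply: near; rewrite !zrE !mulrDl ?mulNr.
- exists (Z.add cx r, Z.sub cy (Z.sub quarter r), Z0); first by apply: (wit _ _ r); auto.
  by apply: near; rewrite !zrE !mulrDl ?mulNr ?mulrDl ?mulNr.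
- exists (Z.sub cx r, Z.add cy (Z.sub quarter r), Z0); first by apply: (wit _ _ r); auto.
  by apply: near; rewrite !zrE !mulrDl ?mulNr.
- exists (Z.sub cx r, Z.sub cy (Z.sub quarter r), Z0); first by apply: (wit _ _ r); auto.
  by apply: near; rewrite !zrE !mulrDl ?mulNr ?mulrDl ?mulNr.
Qed.

(** * From the certificate to a cover *)

(** K is the polygon cut out by all lines of both lists. It contains the closed hull of the balls,
    hence all the bodies, and the two cap bounds add up to its area. *)
Lemma placement_okP (R : realType) (p : Z) (P : placement) (h : R) :
  placement_ok p P ->
  zr R p / zr R unit_length <= h <= zr R (half_length P) / zr R unit_length ->
  exists K : set (R * R),
    [/\ measurable K, convex_set2 K,
        (area K <= ((97 * 10 ^+ 2 + 63) / 10 ^+ 5 : R)%:E)%E,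
        contains_copy K (@unit_perimeter_disk R) /\
          contains_copy K (@unit_perimeter_triangle R) &
        exists cx cy, forall e1 e2, `|e1| <= h -> `|e2| <= 1 / 4 - h ->
          K (cx + e1, cy + e2)].
Proof.
move=> ok hP.
pose bs := balls p P.
pose U := lines bs (upper P); pose L := lines (mirror bs) (lower P).
pose K : set (R * R) := polygon (map (line 1) U ++ map (line (-1)) L).
have S0 := @unit_length_gt0 R.
have bsK : balls_union bs `<=` K.
  move=> z bz; rewrite /K polygon_cat; split.
    by apply: lines_ball => //; rewrite mul1r; case: z bz.
  by apply: lines_ball => //; exact: mirror_union.
have hullK : closed_hull (balls_union bs) `<=` K.
  exact: closed_hull_polygon.
have subK bs' : {subset bs' <= bs} -> closed_hull (balls_union bs') `<=` K.
  move=> sub z zh; apply: hullK => u v c Huvc; apply: zh => w [b /sub bb wb].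
  by apply: Huvc; exists b.
exists K; split.
- exact: measurable_polygon.
- exact: convex_polygon.
- move: ok; rewrite /placement_ok -/bs -/U -/L.
  case UA : (cap_check U) => [A|//]; case LB : (cap_check L) => [B|//].
  move=> /Z.leb_le AB.
  have mcap s hs : measurable (polygon hs `&` [set z : R * R | 0 <= s * z.2]).
    by apply: measurableI; [exact: measurable_polygon|exact: measurable_ge2].
  (* On either side of the x-axis the lines of the other cap are dropped, which only enlarges the
     set. *)
  have Kcaps : K `<=` (polygon (map (line 1) U) `&` [set z | 0 <= 1 * z.2]) `|`
                 (polygon (map (line (-1)) L) `&` [set z | 0 <= -1 * z.2]).
    move=> z; rewrite /K polygon_cat => -[zU zL].
    have [z2|/ltW z2] := leP 0 z.2; [left|right]; split=> //=.
      by rewrite mul1r.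
    by rewrite mulN1r oppr_ge0.
  apply: le_trans (area_setU _ _ _ _ _ (mcap _ _) (mcap _ _) (measurable_polygon _) Kcaps
    (cap_checkP 1 _ _ (or_introl erefl) UA) (cap_checkP (-1) _ _ (or_intror erefl) LB)) _.
  have /(ler_zr R) := AB; rewrite !zrM !zrD !zrM.
  have -> : zr R 1000 = 1000 by rewrite zr.unlock.
  have -> : zr R 100 = 100 by rewrite zr.unlock.
  have -> : zr R 97 = 97 by rewrite zr.unlock.
  have -> : zr R 63 = 63 by rewrite zr.unlock.
  move=> ABR.
  rewrite lee_fin -mulrDl ler_pdivrMr ?exprn_gt0//.
  rewrite expr2; lra.
- split.
    apply: (disk_contained _ (disk_y P)) => z bz; apply: bsK.
    by exists (Z0, disk_y P, disk_radius); rewrite // /bs /balls mem_head.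
  apply: (triangle_contained _ (tilt P) (tri_x P) (tri_y P)); apply: subK => b.
  by move=> bt; rewrite /bs /balls in_cons mem_cat bt orbT.
- exists (zr R (rect_x P) / zr R unit_length), (zr R (rect_y P) / zr R unit_length).
  move=> e1 e2 e1h e2h.
  have := rectangle_corners_hull _ (rect_x P) (rect_y P) _ _ _ _ _ hP e1h e2h.
  apply: subK => b bc.
  by rewrite /bs /balls in_cons mem_cat bc !orbT.
Qed.

(** The entry sought is the first whose [half_length] reaches h; the table cannot run out, since its
    last piece reaches 1/4 > h. *)
Lemma table_okP (R : realType) (Ps : seq placement) (p : Z) (h : R) :
  table_ok p Ps -> zr R p / zr R unit_length <= h < 1 / 4 ->
  exists r P, placement_ok r P /\
   zr R r / zr R unit_length <= h <= zr R (half_length P) / zr R unit_length.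
Proof.
have S0 := @unit_length_gt0 R.
elim: Ps p => [|P Ps IH] p /=.
  move=> /Z.leb_le /(ler_zr R) qp /andP[ph]; rewrite -zr_quarter => hq.
  have := le_lt_trans ph hq; rewrite ltr_pM2r ?invr_gt0// => /lt_le_trans /(_ qp).
  by rewrite ltxx.
move=> /andP[Pok Psok] /andP[ph h4].
have [hP|/ltW hP] := leP h (zr R (half_length P) / zr R unit_length).
  by exists p, P; rewrite ph hP.
by apply: IH Psok _; rewrite hP h4.
Qed.

(** * The numerical placements *)

Section Table.
Local Open Scope Z_scope.

(* Found by numerical minimisation of the area of the hull. *)
Definition table : seq placement := [::
  Placement 18177530 (-474996) 0 (-18770597) 8534289 (-593068) 1711785
    [:: (-999999, -999999); (-971021, -971021); (-414212, -414212); (-70834, 79548); (543489, 543489); (999999, 999999)]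
    [:: (-999999, -999999); (-414214, -414214); (-270317, -146727); (284618, 363356); (414214, 414214); (999999, 999999)];
  Placement 20214464 378038 0 (-1505973) (-17527566) 3276729 (-261962)
    [:: (-999999, -999999); (-469009, -469008); (-52808, 251031); (414214, 414214); (999999, 999999)]
    [:: (-999999, -999999); (-441379, -269154); (179092, 235553); (414214, 414214); (999999, 999999)];
  Placement 21227181 356583 (-3842335) (-1699430) (-21090511) 2886191 (-3772802)
    [:: (-999999, -999999); (-427625, -427623); (-19547, 272870); (414214, 414214); (494173, 494173); (999999, 999999)]
    [:: (-999999, -999999); (-433367, -258151); (155664, 276562); (414214, 414214); (999998, 999998); (999999, 999999)];
  Placement 21806205 348539 0 (-1598334) (-17086047) 2707432 215340
    [:: (-999999, -999999); (-414214, -405659); (-2204, 282301); (999920, 999920); (999999, 999999)]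
    [:: (-999999, -999999); (-430255, -242893); (146029, 293112); (414214, 414214); (999999, 999999)];
  Placement 22137264 338439 0 (-1619068) (-17023521) 2725697 233605
    [:: (-999999, -999999); (-414214, -379608); (9648, 287001); (999960, 999960); (999999, 999999)]
    [:: (-999999, -999999); (-430933, -239034); (140727, 298279); (414214, 414214); (999999, 999999)];
  Placement 22354940 331733 0 (-1657970) (-16979255) 2711287 219195
    [:: (-999999, -999999); (-414214, -364445); (18036, 290494); (290495, 290495); (999975, 999975); (999999, 999999)]
    [:: (-999999, -999999); (-429465, -237160); (136356, 300860); (414214, 414214); (999999, 999999)];
  Placement 22498066 327183 0 (-1691293) (-16948228) 2697499 201444
    [:: (-999999, -999999); (-414350, -354800); (23921, 292973); (999669, 999669); (999999, 999999)]
    [:: (-999999, -999999); (-428108, -236053); (133125, 302375); (414214, 414214); (999999, 999999)];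
  Placement 22606290 324111 0 (-1708656) (-16932413) 2680942 188850
    [:: (-999999, -999999); (-414214, -347690); (27552, 294703); (999635, 999635); (999999, 999999)]
    [:: (-999999, -999999); (-426929, -235495); (131460, 303445); (414214, 414214); (999999, 999999)];
  Placement 22688123 321722 0 (-1723107) (-16918840) 2669005 176913
    [:: (-999999, -999999); (-414214, -342346); (30512, 296040); (999652, 999652); (999999, 999999)]
    [:: (-999999, -999999); (-425999, -234994); (130036, 304178); (414214, 414214); (999999, 999999)];
  Placement 22752019 319924 (-2416406) (-1730903) (-19325051) 2660517 (-2247981)
    [:: (-999999, -999999); (-414214, -338172); (32775, 297004); (999999, 999999)]
    [:: (-999999, -999999); (-425343, -234494); (129029, 304731); (414214, 414214); (999997, 999997); (999999, 999999)];
  Placement 22801791 318746 0 (-1720539) (-16904059) 2662429 170337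
    [:: (-999999, -999999); (-414214, -334421); (34182, 297456); (999769, 999769); (999999, 999999)]
    [:: (-999999, -999999); (-425407, -233723); (128875, 305222); (414214, 414214); (999999, 999999)];
  Placement 22845070 317315 (-2309677) (-1742859) (-19204284) 2646840 (-2154930)
    [:: (-999999, -999999); (-414214, -332135); (36028, 298437); (298507, 298507); (999999, 999999)]
    [:: (-999999, -999999); (-424319, -233850); (127610, 305476); (414214, 414214); (999993, 999993); (999999, 999999)];
  Placement 22877796 316219 0 (-1757880) (-16886173) 2637365 145273
    [:: (-999999, -999999); (-414214, -330360); (37558, 299132); (999199, 999199); (999999, 999999)]
    [:: (-999999, -999999); (-423657, -233769); (126587, 305726); (414214, 414214); (999999, 999999)];
  Placement 22906252 316034 (-2255622) (-1740219) (-19145960) 2632997 (-2093748)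
    [:: (-999999, -999999); (-414214, -414214); (-413531, -328515); (37473, 299075); (299184, 299184); (999999, 999999)]
    [:: (-999999, -999999); (-424017, -233405); (127313, 306409); (414214, 414214); (999998, 999998); (999999, 999999)];
  Placement 22930998 314602 0 (-1780451) (-16879246) 2617850 127904
    [:: (-999999, -999999); (-414214, -414214); (-414144, -327356); (39352, 300292); (998340, 998340); (999999, 999999)]
    [:: (-999999, -999999); (-422395, -234109); (125528, 306081); (414214, 414214); (999999, 999999)];
  Placement 22952515 314464 0 (-1759431) (-16878999) 2622139 143896
    [:: (-999999, -999999); (-414214, -414214); (-413766, -325804); (39630, 300056); (999046, 999046); (999999, 999999)]
    [:: (-999999, -999999); (-423030, -233256); (125956, 306557); (414214, 414214); (999999, 999999)];
  Placement 22971226 314032 0 (-1759157) (-16876838) 2618705 144219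
    [:: (-999999, -999999); (-414214, -414214); (-413646, -324680); (40181, 300266); (997341, 997341); (999999, 999999)]
    [:: (-999999, -999999); (-422909, -233072); (125781, 306774); (414214, 414214); (999999, 999999)];
  Placement 22987497 313469 0 (-1771240) (-16871479) 2609854 138677
    [:: (-999999, -999999); (-414214, -414214); (-413541, -324096); (41032, 300667); (300720, 300720); (999999, 999999)]
    [:: (-999999, -999999); (-422425, -233120); (125074, 306920); (414214, 414214); (999999, 999999)];
  Placement 23001645 313207 0 (-1758960) (-16870957) 2617073 140988
    [:: (-999999, -999999); (-414214, -414214); (-413699, -322690); (41386, 300631); (997716, 997716); (999999, 999999)]
    [:: (-999999, -999999); (-422723, -232590); (125292, 306980); (414214, 414214); (999999, 999999)];
  Placement 23015793 312393 (-2103482) (-1786515) (-18969723) 2603528 (-1984207)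
    [:: (-999999, -999999); (-414214, -414214); (-413963, -322170); (42288, 301431); (999790, 999790); (999999, 999999)]
    [:: (-999999, -999999); (-421575, -233305); (124310, 306801); (414214, 414214); (999999, 999999)];
  Placement 23028096 312357 (-2101664) (-1776914) (-18968567) 2602055 (-1971904)
    [:: (-999999, -999999); (-414214, -414214); (-413581, -321488); (42332, 301324); (301721, 301721); (999999, 999999)]
    [:: (-999999, -999999); (-421850, -232976); (124570, 307161); (414214, 414214); (999996, 999996); (999999, 999999)];
  Placement 23038794 312366 0 (-1769702) (-16868100) 2598285 140210
    [:: (-999999, -999999); (-414214, -414214); (-413128, -321028); (42274, 301238); (996421, 996421); (999999, 999999)]
    [:: (-999999, -999999); (-422050, -232786); (124824, 307542); (414214, 414214); (999999, 999999)];
  Placement 23049492 312240 (-2095317) (-1765671) (-18963240) 2595962 (-1950508)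
    [:: (-999999, -999999); (-414214, -414214); (-412908, -320451); (42427, 301251); (301278, 301278); (999723, 999723); (999999, 999999)]
    [:: (-999999, -999999); (-422111, -232612); (124895, 307757); (414214, 414214); (999999, 999999)];
  Placement 23058794 311455 (-2062491) (-1786282) (-18924512) 2593141 (-1941206)
    [:: (-999999, -999999); (-414214, -414214); (-413570, -319727); (43456, 301903); (302505, 302505); (999999, 999999)]
    [:: (-999999, -999999); (-421267, -232955); (123960, 307350); (414214, 414214); (999996, 999996); (999999, 999999)];
  Placement 23066883 311432 0 (-1782226) (-16862354) 2589929 128257
    [:: (-999999, -999999); (-414214, -414214); (-413247, -319413); (43477, 301864); (996344, 996344); (999999, 999999)]
    [:: (-999999, -999999); (-421377, -232820); (124074, 307622); (414214, 414214); (999999, 999999)];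
  Placement 23074973 311442 0 (-1777222) (-16863099) 2586496 136103
    [:: (-999999, -999999); (-414214, -414214); (-412890, -319113); (43442, 301800); (997073, 997073); (999999, 999999)]
    [:: (-999999, -999999); (-421508, -232681); (124243, 307908); (414214, 414214); (999999, 999999)];
  Placement 23082007 310994 (-2042343) (-1790379) (-18902200) 2581742 (-1917993)
    [:: (-999999, -999999); (-414214, -414214); (-413113, -318766); (44008, 302196); (302883, 302883); (999999, 999999)]
    [:: (-999999, -999999); (-420978, -232943); (123691, 307775); (414214, 414214); (999998, 999998); (999999, 999999)];
  Placement 23089041 310899 (-2038492) (-1784437) (-18898139) 2582870 (-1910959)
    [:: (-999999, -999999); (-414214, -414214); (-413049, -318181); (44153, 302161); (302527, 302527); (999999, 999999)]
    [:: (-999999, -999999); (-421109, -232689); (123799, 307880); (414214, 414214); (999722, 999722); (999999, 999999)];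
  Placement 23095158 310900 0 (-1781605) (-16860182) 2580629 132734
    [:: (-999999, -999999); (-414214, -414214); (-412814, -317988); (44128, 302130); (991833, 991833); (999999, 999999)]
    [:: (-999999, -999999); (-421196, -232620); (123905, 308081); (414214, 414214); (999999, 999999)];
  Placement 23101274 310837 (-2034523) (-1780419) (-18894626) 2577855 (-1898726)
    [:: (-999999, -999999); (-414214, -414214); (-412631, -317746); (44199, 302149); (999512, 999512); (999999, 999999)]
    [:: (-999999, -999999); (-421199, -232566); (123923, 308235); (414214, 414214); (999999, 999999)];
  Placement 23107391 310463 (-2019544) (-1785704) (-18877940) 2568410 (-1887366)
    [:: (-999999, -999999); (-414214, -414214); (-412450, -317070); (44630, 302417); (302731, 302731); (999999, 999999)]
    [:: (-999999, -999999); (-420777, -232638); (123667, 308342); (414214, 414214); (997114, 997114); (999999, 999999)];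
  Placement 23112710 310297 (-2012367) (-1781354) (-18869619) 2566464 (-1877340)
    [:: (-999999, -999999); (-414214, -414214); (-412300, -316437); (44906, 302428); (999999, 999999)]
    [:: (-999999, -999999); (-420800, -232372); (123663, 308479); (414214, 414214); (995331, 995331); (999999, 999999)];
  Placement 23118028 309664 (-1984562) (-1787832) (-18837869) 2554440 (-1857320)
    [:: (-999999, -999999); (-414214, -414214); (-412170, -315244); (45746, 302822); (302854, 302854); (999999, 999999)]
    [:: (-999999, -999999); (-420167, -232310); (123192, 308526); (414214, 414214); (989460, 989460); (999999, 999999)];
  Placement 23123347 309655 (-1983605) (-1784363) (-18837417) 2552635 (-1851824)
    [:: (-999999, -999999); (-414214, -414214); (-411971, -314991); (45738, 302787); (302865, 302865); (999999, 999999)]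
    [:: (-999999, -999999); (-420248, -232213); (123309, 308693); (414214, 414214); (989359, 989359); (999999, 999999)];
  Placement 23127972 309170 (-1962353) (-1788415) (-18813065) 2544034 (-1835871)
    [:: (-999999, -999999); (-414214, -414214); (-411871, -314035); (46398, 303075); (999999, 999999)]
    [:: (-999999, -999999); (-419805, -232123); (122961, 308743); (414214, 414214); (984885, 984885); (999999, 999999)];
  Placement 23132597 309136 (-1960316) (-1786032) (-18811357) 2541571 (-1830311)
    [:: (-999999, -999999); (-414214, -414214); (-411685, -313782); (46419, 303067); (303120, 303120); (999999, 999999)]
    [:: (-999999, -999999); (-419833, -232054); (123039, 308893); (414214, 414214); (984474, 984474); (999999, 999999)];
  Placement 23137222 308871 (-1948419) (-1787031) (-18798042) 2535909 (-1819561)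
    [:: (-999999, -999999); (-414214, -414214); (-411546, -313173); (46766, 303212); (303257, 303257); (999999, 999999)]
    [:: (-999999, -999999); (-419615, -231979); (122898, 308986); (414214, 414214); (981970, 981970); (999999, 999999)];
  Placement 23141848 308506 (-1932214) (-1789513) (-18779691) 2528584 (-1806397)
    [:: (-999999, -999999); (-414214, -414214); (-411415, -312411); (47252, 303424); (999999, 999999)]
    [:: (-999999, -999999); (-419285, -231903); (122663, 309063); (414214, 414214); (978477, 978477); (999999, 999999)];
  Placement 23145869 307937 (-1907312) (-1795263) (-18751060) 2518760 (-1788988)
    [:: (-999999, -999999); (-414214, -414214); (-411346, -311354); (48030, 303774); (303821, 303821); (999999, 999999)]
    [:: (-999999, -999999); (-418738, -231829); (122226, 309078); (414214, 414214); (973116, 973116); (999999, 999999)];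
  Placement 23149891 307928 (-1906457) (-1792809) (-18750607) 2516994 (-1784655)
    [:: (-999999, -999999); (-414214, -414214); (-411183, -311165); (48024, 303753); (999999, 999999)]
    [:: (-999999, -999999); (-418788, -231764); (122311, 309212); (414214, 414214); (972919, 972919); (999999, 999999)];
  Placement 23153913 307683 (-1895438) (-1793895) (-18738269) 2511623 (-1774796)
    [:: (-999999, -999999); (-414214, -414214); (-411055, -310614); (48346, 303889); (999999, 999999)]
    [:: (-999999, -999999); (-418580, -231700); (122177, 309296); (414214, 414214); (970496, 970496); (999999, 999999)];
  Placement 23157935 307516 (-1887775) (-1793824) (-18729857) 2507433 (-1766745)
    [:: (-999999, -999999); (-414214, -414214); (-410914, -310184); (48560, 303973); (304010, 304010); (999999, 999999)]
    [:: (-999999, -999999); (-418458, -231636); (122114, 309398); (414214, 414214); (968799, 968799); (999999, 999999)];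
  Placement 23161956 307348 (-1880068) (-1793788) (-18721391) 2503625 (-1758977)
    [:: (-999999, -999999); (-414214, -414214); (-410796, -309754); (48775, 304059); (999999, 999999)]
    [:: (-999999, -999999); (-418339, -231572); (122051, 309486); (414214, 414214); (967200, 967200); (999999, 999999)];
  Placement 23165978 307240 (-1874957) (-1792855) (-18715948) 2500434 (-1752384)
    [:: (-999999, -999999); (-414214, -414214); (-410653, -309416); (48908, 304104); (304134, 304134); (999999, 999999)]
    [:: (-999999, -999999); (-418282, -231508); (122042, 309596); (414214, 414214); (966082, 966082); (999999, 999999)];
  Placement 23170000 307019 (-1864965) (-1793595) (-18704805) 2495579 (-1743213)
    [:: (-999999, -999999); (-414214, -414214); (-410531, -308904); (49199, 304224); (999999, 999999)]
    [:: (-999999, -999999); (-418102, -231443); (121929, 309681); (414214, 414214); (963895, 963895); (999999, 999999)];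
  Placement 23174022 306796 (-1854873) (-1794368) (-18693558) 2490426 (-1733769)
    [:: (-999999, -999999); (-414214, -414214); (-410394, -308389); (49492, 304347); (304383, 304383); (999999, 999999)]
    [:: (-999999, -999999); (-417919, -231380); (121814, 309773); (414214, 414214); (961604, 961604); (999999, 999999)];
  Placement 23178044 306592 (-1845571) (-1794787) (-18683264) 2486181 (-1725178)
    [:: (-999999, -999999); (-414214, -414214); (-410287, -307898); (49757, 304456); (999999, 999999)]
    [:: (-999999, -999999); (-417762, -231315); (121721, 309851); (414214, 414214); (959638, 959638); (999999, 999999)];
  Placement 23182065 306203 (-1828306) (-1797985) (-18663626) 2478446 (-1711779)
    [:: (-999999, -999999); (-414214, -414214); (-410172, -307128); (50284, 304689); (304718, 304718); (999999, 999999)]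
    [:: (-999999, -999999); (-417399, -231249); (121451, 309911); (414214, 414214); (955703, 955703); (999999, 999999)];
  Placement 23186087 306094 (-1823111) (-1797060) (-18658121) 2475430 (-1705316)
    [:: (-999999, -999999); (-414214, -414214); (-410042, -306787); (50417, 304735); (999999, 999999)]
    [:: (-999999, -999999); (-417343, -231186); (121444, 310014); (414214, 414214); (954588, 954588); (999999, 999999)];
  Placement 23190109 305770 (-1808630) (-1799288) (-18641750) 2468782 (-1693497)
    [:: (-999999, -999999); (-414214, -414214); (-409923, -306117); (50853, 304925); (304932, 304932); (999999, 999999)]
    [:: (-999999, -999999); (-417052, -231121); (121236, 310085); (414214, 414214); (951277, 951277); (999999, 999999)];
  Placement 23194131 305637 (-1802399) (-1798697) (-18635027) 2465363 (-1686417)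
    [:: (-999999, -999999); (-414214, -414214); (-409794, -305740); (51021, 304987); (999999, 999999)]
    [:: (-999999, -999999); (-416970, -231057); (121206, 310185); (414214, 414214); (949897, 949897); (999999, 999999)];
  Placement 23198152 305564 (-1798756) (-1797237) (-18631337) 2462955 (-1680812)
    [:: (-999999, -999999); (-414214, -414214); (-409661, -305455); (51104, 305009); (999999, 999999)]
    [:: (-999999, -999999); (-416955, -230994); (121233, 310294); (414214, 414214); (949127, 949127); (999999, 999999)];
  Placement 23202778 305165 (-1780914) (-1800446) (-18611156) 2454517 (-1666713)
    [:: (-999999, -999999); (-414214, -414214); (-409522, -304656); (51640, 305250); (999999, 999999)]
    [:: (-999999, -999999); (-416576, -230931); (120966, 310368); (414214, 414214); (944984, 944984); (999999, 999999)];
  Placement 23207403 304973 (-1771976) (-1800222) (-18601440) 2449949 (-1657513)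
    [:: (-999999, -999999); (-414214, -414214); (-409377, -304151); (51883, 305347); (999999, 999999)]
    [:: (-999999, -999999); (-416441, -230858); (120904, 310476); (414214, 414214); (942939, 942939); (999999, 999999)];
  Placement 23212028 304614 (-1755916) (-1802589) (-18583264) 2442554 (-1644257)
    [:: (-999999, -999999); (-414214, -414214); (-409241, -303408); (52372, 305555); (305568, 305568); (999999, 999999)]
    [:: (-999999, -999999); (-416125, -230779); (120673, 310560); (414214, 414214); (939199, 939199); (999999, 999999)];
  Placement 23216653 304474 (-1749275) (-1801754) (-18576173) 2438934 (-1636508)
    [:: (-999999, -999999); (-414214, -414214); (-409100, -302996); (52547, 305619); (999999, 999999)]
    [:: (-999999, -999999); (-416046, -230708); (120652, 310673); (414214, 414214); (937729, 937729); (999999, 999999)];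
  Placement 23221972 304050 (-1730194) (-1804814) (-18554686) 2429847 (-1621072)
    [:: (-999999, -999999); (-414214, -414214); (-408939, -302125); (53115, 305872); (999999, 999999)]
    [:: (-999999, -999999); (-415653, -230633); (120382, 310763); (414214, 414214); (933211, 933211); (999999, 999999)];
  Placement 23227290 303830 (-1719985) (-1804652) (-18543530) 2424582 (-1610539)
    [:: (-999999, -999999); (-414214, -414214); (-408773, -301558); (53401, 305984); (306003, 306003); (999999, 999999)]
    [:: (-999999, -999999); (-415500, -230548); (120304, 310889); (414214, 414214); (930826, 930826); (999999, 999999)];
  Placement 23232609 303853 (-1720348) (-1800923) (-18544696) 2423292 (-1605992)
    [:: (-999999, -999999); (-414214, -414214); (-408586, -301365); (53344, 305932); (305940, 305940); (999999, 999999)]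
    [:: (-999999, -999999); (-415610, -230465); (120451, 311056); (414214, 414214); (930929, 930929); (999999, 999999)];
  Placement 23238726 302846 (-1675738) (-1811961) (-18493581) 2404443 (-1575445)
    [:: (-999999, -999999); (-414214, -414214); (-408453, -299564); (54733, 306572); (306587, 306587); (999999, 999999)]
    [:: (-999999, -999999); (-414600, -230371); (119661, 311068); (414214, 414214); (920288, 920288); (999999, 999999)];
  Placement 23244842 302896 (-1677207) (-1807498) (-18496121) 2403147 (-1570784)
    [:: (-999999, -999999); (-414214, -414214); (-408230, -299390); (54637, 306498); (999999, 999999)]
    [:: (-999999, -999999); (-414748, -230281); (119846, 311268); (414214, 414214); (920606, 920606); (999999, 999999)];
  Placement 23251877 302834 (-1673571) (-1804178) (-18492971) 2399453 (-1562636)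
    [:: (-999999, -999999); (-414214, -414214); (-407984, -298999); (54683, 306497); (306502, 306502); (999999, 999999)]
    [:: (-999999, -999999); (-414772, -230187); (119958, 311469); (414214, 414214); (919682, 919682); (999999, 999999)];
  Placement 23258911 301505 (-1615088) (-1815991) (-18425370) 2377078 (-1522089)
    [:: (-999999, -999999); (-414214, -414214); (-407867, -296532); (56599, 307291); (307299, 307299); (999999, 999999)]
    [:: (-999999, -999999); (-414214, -414214); (-413543, -229908); (118925, 311462); (414214, 414214); (905072, 905072); (999999, 999999)];
  Placement 23267000 301687 (-1622312) (-1809365) (-18434637) 2376994 (-1519607)
    [:: (-999999, -999999); (-414214, -414214); (-407573, -296546); (56316, 307125); (999999, 999999)]
    [:: (-999999, -999999); (-414214, -414214); (-413837, -229810); (119240, 311729); (414214, 414214); (906866, 906866); (999999, 999999)];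
  Placement 23275089 301411 (-1609313) (-1808373) (-18420582) 2369813 (-1505009)
    [:: (-999999, -999999); (-414214, -414214); (-407315, -295789); (56676, 307257); (307260, 307260); (999999, 999999)]
    [:: (-999999, -999999); (-414214, -414214); (-413668, -229683); (119169, 311932); (414214, 414214); (903623, 903623); (999999, 999999)];
  Placement 23284392 300989 (-1589702) (-1808572) (-18399080) 2359011 (-1485342)
    [:: (-999999, -999999); (-414214, -414214); (-406998, -294744); (57235, 307479); (999999, 999999)]
    [:: (-999999, -999999); (-414214, -414214); (-413343, -229534); (119002, 312156); (414214, 414214); (898447, 898447); (999999, 999999)];
  Placement 23295090 300100 (-1549430) (-1814599) (-18353729) 2340873 (-1453248)
    [:: (-999999, -999999); (-414214, -414214); (-406716, -292926); (58456, 308005); (999999, 999999)]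
    [:: (-999999, -999999); (-414214, -414214); (-412549, -229354); (118437, 312318); (414214, 414214); (888336, 888336); (999999, 999999)];
  Placement 23305788 298854 (-1493258) (-1823997) (-18290047) 2316660 (-1410348)
    [:: (-999999, -999999); (-414214, -414214); (-406411, -290465); (60200, 308751); (308761, 308761); (999999, 999999)]
    [:: (-999999, -999999); (-414214, -414214); (-411424, -229107); (117590, 312470); (414214, 414214); (873592, 873592); (999999, 999999)];
  Placement 23318091 298822 (-1490443) (-1818511) (-18288410) 2311552 (-1399038)
    [:: (-999999, -999999); (-414214, -414214); (-406012, -289999); (60186, 308714); (308718, 308718); (999999, 999999)]
    [:: (-999999, -999999); (-414214, -414214); (-411531, -228984); (117806, 312813); (414214, 414214); (872871, 872871); (999999, 999999)];
  Placement 23332239 298052 (-1454801) (-1820793) (-18248984) 2293660 (-1366332)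
    [:: (-999999, -999999); (-414214, -414214); (-405587, -288235); (61232, 309142); (999999, 999999)]
    [:: (-999999, -999999); (-414214, -414214); (-410913, -228760); (117429, 313110); (414214, 414214); (863329, 863329); (999999, 999999)];
  Placement 23348509 296939 (-1403606) (-1826198) (-18191902) 2269487 (-1322684)
    [:: (-999999, -999999); (-414214, -414214); (-405121, -285835); (62765, 309783); (999999, 999999)]
    [:: (-999999, -999999); (-414214, -414214); (-409977, -228485); (116804, 313414); (414214, 414214); (849503, 849503); (999999, 999999)];
  Placement 23370027 296014 (-1360127) (-1826159) (-18144378) 2245395 (-1279138)
    [:: (-999999, -999999); (-414214, -414214); (-404434, -283550); (64023, 310268); (310271, 310271); (999999, 999999)]
    [:: (-999999, -999999); (-414214, -414214); (-409277, -228143); (116451, 313902); (414214, 414214); (836885, 836885); (999999, 999999)];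
  Placement 23394772 294697 (-1298513) (-1829362) (-18076582) 2214094 (-1221828)
    [:: (-999999, -999999); (-414214, -414214); (-403682, -280508); (65827, 310999); (999999, 999999)]
    [:: (-999999, -999999); (-414214, -414214); (-408246, -227752); (115843, 314441); (414214, 414214); (819071, 819071); (999999, 999999)];
  Placement 23427497 292920 (-1215348) (-1833962) (-17984860) 2171451 (-1145535)
    [:: (-999999, -999999); (-414214, -414214); (-402693, -276458); (68300, 311987); (999999, 999999)]
    [:: (-999999, -999999); (-414214, -414214); (-406824, -227215); (114995, 315123); (414214, 414214); (794072, 794072); (999999, 999999)];
  Placement 23470777 290138 (-1085713) (-1844596) (-17840701) 2107669 (-1031876)
    [:: (-999999, -999999); (-414214, -414214); (-401399, -270432); (72280, 313566); (999999, 999999)]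
    [:: (-999999, -999999); (-414214, -414214); (-404559, -226412); (113491, 315988); (414214, 414214); (753655, 753655); (999999, 999999)];
  Placement 23528014 289060 (-1027702) (-1842181) (-17784657) 2061852 (-958991)
    [:: (-999999, -999999); (-414214, -414214); (-399742, -267161); (73244, 314245); (314251, 314251); (999999, 999999)]
    [:: (-999999, -999999); (-414214, -414214); (-403744, -226481); (113715, 317335); (414214, 414214); (734968, 734968); (999999, 999999)];
  Placement 23571159 285321 (-854400) (-1849811) (-17589474) 1984156 (-810798)
    [:: (-999999, -999999); (-414214, -414214); (-398416, -259079); (79034, 316233); (999999, 999999)]
    [:: (-999999, -999999); (-414214, -414214); (-400927, -224914); (111604, 318382); (414214, 414214); (673201, 673201); (999999, 999999)];
  Placement 23695616 269220 (-63338) (-2110854) (-16735053) 1777598 (-60519)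
    [:: (-999999, -999999); (-414214, -414214); (-394114, -232808); (98365, 320934); (414214, 414214); (414216, 414216); (999999, 999999)]
    [:: (-999999, -999999); (-414214, -414214); (-394273, -230310); (100759, 321062); (414214, 414214); (441643, 441643); (999999, 999999)];
  Placement 23983493 267951 (-71) (-2112182) (-16666764) 1755264 19
    [:: (-999999, -999999); (-414214, -414214); (-393841, -229926); (100266, 322153); (414214, 414214); (414216, 414216); (999999, 999999)]
    [:: (-999999, -999999); (-414214, -414214); (-393846, -229926); (100273, 322157); (414207, 414207); (999999, 999999)];
  Placement 25000000 267817 5758 (-1899663) (-16659545) 1597672 455
    [:: (-999999, -999999); (-414214, -414214); (-390567, -220730); (104632, 326605); (999999, 999999)]
    [:: (-999999, -999999); (-414214, -414214); (-390282, -220828); (104215, 326369); (999999, 999999)]].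

End Table.

(** The whole numerical content of the proof, settled by evaluation in integer arithmetic. *)
Lemma table_ok_table : table_ok eighth table.
Proof. vm_cast_no_check (erefl true). Qed.

Lemma zr_eighth (R : realType) : zr R eighth / zr R unit_length = 1 / 8.
Proof.
have -> : zr R unit_length = 8 * zr R eighth.
  have -> : unit_length = Z.mul 8 eighth by [].
  by rewrite zrM; congr (_ * _); rewrite zr.unlock.
by field; rewrite gt_eqF// zr_gt0.
Qed.

(** * The covering theorem *)

(** The range of h is that of half the longer side: the two half-sides are positive and add up to
    1/4. *)
Lemma cover_exists (R : realType) (h : R) : 1 / 8 <= h < 1 / 4 ->
  exists K : set (R * R),
    [/\ measurable K, convex_set2 K,
        (area K <= ((97 * 10 ^+ 2 + 63) / 10 ^+ 5 : R)%:E)%E,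
        contains_copy K (@unit_perimeter_disk R) /\
          contains_copy K (@unit_perimeter_triangle R) &
        exists cx cy, forall e1 e2, `|e1| <= h -> `|e2| <= 1 / 4 - h ->
          K (cx + e1, cy + e2)].
Proof.
move=> /andP[h8 h4].
have hb : zr R eighth / zr R unit_length <= h < 1 / 4 by rewrite h4 andbT zr_eighth.
have [r [P [Pok hP]]] := table_okP R table eighth h table_ok_table hb.
exact: placement_okP Pok hP.
Qed.

Theorem theorem2 (R : realType) (a b : R) (ha : 0 < a) (hb : 0 < b)
    (hper : 2 * (a + b) = 1) :
  exists K : set (R * R),
    [/\ measurable K, convex_set2 K,
        (area K <= ((97 * 10 ^+ 2 + 63) / 10 ^+ 5 : R)%:E)%E &
      [/\ contains_copy K (rectangle a b),
        contains_copy K (@unit_perimeter_disk R)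
      & contains_copy K (@unit_perimeter_triangle R)]].
Proof.
have [ba|/ltW ab] := leP b a.
  have [K [mK cK aK [dK tK] [cx [cy rK]]]] := @cover_exists R (a / 2) ltac:(lra).
  exists K; split=> //; split=> //.
  (* The longer side is already horizontal; the translation takes the centre of the rectangle to
     (cx, cy). *)
  exists 0, (cx - a / 2), (cy - b / 2) => _ [p [/andP[p0 pa] /andP[q0 qb]] <-].
  rewrite /rigid_motion cos0 sin0.
  have -> : (1 * p.1 - 0 * p.2 + (cx - a / 2), 0 * p.1 + 1 * p.2 + (cy - b / 2)) =
    (cx + (p.1 - a / 2), cy + (p.2 - b / 2)) by congr (_, _); ring.
  by apply: rK; rewrite ler_norml; apply/andP; split; lra.
have [K [mK cK aK [dK tK] [cx [cy rK]]]] := @cover_exists R (b / 2) ltac:(lra).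
exists K; split=> //; split=> //.
(* A quarter turn makes the longer side b horizontal and takes the centre (a / 2, b / 2) to (- b /
   2, a / 2), which the translation corrects. *)
exists (pi / 2), (cx + b / 2), (cy - a / 2) => _ [p [/andP[p0 pa] /andP[q0 qb]] <-].
rewrite /rigid_motion cos_pihalf sin_pihalf.
have -> : (0 * p.1 - 1 * p.2 + (cx + b / 2), 1 * p.1 + 0 * p.2 + (cy - a / 2)) =
  (cx + (b / 2 - p.2), cy + (p.1 - a / 2)) by congr (_, _); ring.
by apply: rK; rewrite ler_norml; apply/andP; split; lra.
Qed.
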